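(* Let $\mathbf{w}\in\Sigma^\omega$ be a linearly recurrent word with $\mathbf{A}_\mathbf{w},\mathbf{R}_\mathbf{w}<\infty$. Then for every $n\ge1$, $\mathbf{w}[0..n-1]$ has a string attractor of size $O(\mathbf{A}_\mathbf{w}\log\mathbf{R}_\mathbf{w})$, where the implied constant is absolute (in particular independent of $n$).
   Context: $\Sigma$ is a finite alphabet; words are indexed from $0$. The appearance constant $\mathbf{A}_\mathbf{w}$ is the least constant $C$ such that for every $m\ge1$, every length-$m$ factor of $\mathbf{w}$ has an occurrence in the prefix of length at most $Cm$. $\mathbf{w}$ is linearly recurrent if every factor occurs infinitely often and there is a constant $C$ such that, for every $m$, two consecutive occurrences of every length-$m$ factor (and also the beginning of the word and the first occurrence) are separated by at most $Cm$ positions; the recurrence constant $\mathbf{R}_\mathbf{w}$ is the least such $C$. A string attractor of a finite word $x=x[0..n-1]$ is a set $S\subseteq\{0,\ldots,n-1\}$ such that every nonempty factor of $x$ has an occurrence $x[p..q]$ with $p\le i\le q$ for some $i\in S$.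
   Formalization: The bound proved is K·A_w·(1 + ln R_w) with absolute K, in place of O(A_w log R_w): for a constant word aaa… one has R_w = 1, so log R_w = 0 although an attractor needs a position; for all other words R_w ≥ 2 and the two bounds agree up to an absolute factor. *)

(* Defs.v *)
From mathcomp Require Import all_boot.
From Stdlib Require Import Reals.
Set Implicit Arguments. Unset Strict Implicit. Unset Printing Implicit Defensive.

Definition word (S : finType) := nat -> S.

Definition occ_at (S : finType) (w : word S) (m i j : nat) : Prop :=
  forall k, k < m -> w (j + k) = w (i + k).

Definition appearance_bound (S : finType) (w : word S) (C : R) : Prop :=
  forall m i, 0 < m -> exists j, occ_at w m i j /\ (INR (j + m) <= C * INR m)%R.

Definition uniformly_occurring (S : finType) (w : word S) : Prop :=
  forall m i N, exists j, N <= j /\ occ_at w m i j.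

Definition recurrence_bound (S : finType) (w : word S) (C : R) : Prop :=
  forall m i, 0 < m ->
    (forall j, occ_at w m i j -> (forall j', j' < j -> ~ occ_at w m i j') ->
        (INR j <= C * INR m)%R) /\
    (forall j j', j < j' -> occ_at w m i j -> occ_at w m i j' ->
        (forall k, j < k -> k < j' -> ~ occ_at w m i k) ->
        (INR (j' - j) <= C * INR m)%R).

Definition linearly_recurrent (S : finType) (w : word S) : Prop :=
  uniformly_occurring w /\ exists C, recurrence_bound w C.

Definition least_const (P : R -> Prop) (C : R) : Prop :=
  P C /\ forall C', P C' -> (C <= C')%R.

Definition prefix_string_attractor (S : finType) (w : word S) (n : nat)
    (A : {set 'I_n}) : Prop :=
  forall p q, p <= q -> q < n ->
    exists p', [/\ p' + (q - p) < n, occ_at w (q - p).+1 p p' &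
      exists s : 'I_n, s \in A /\ p' <= s <= p' + (q - p)].

(* Main.v *)
Require Import Defs.
From mathcomp Require Import all_boot zify.
From Stdlib Require Import ZArith Reals Lra.
From mathcomp Require Import ssrnat.
Set Implicit Arguments. Unset Strict Implicit. Unset Printing Implicit Defensive.

(** Cut the prefix of length [4 a m] into [4 a] windows of length [m], where [a]
    bounds the appearance constant.  One position per window, chosen anywhere
    in it, is met by an occurrence of every factor of length in [2m-1, 4m].
    This freedom lets a single set serve many scales at once: if [M] is large
    enough compared to [m], every window of length [M] contains, by linear
    recurrence, a copy of the prefix of length [4 a m], and in the [k]-th window
    one picks the copy of the position already chosen in the [k]-th window of
    length [m].  The ratio [M / m] is [O(a R) = O(R^2)], because [A <= R + 1],
    so [O(log R)] such chains of scales cover all powers of two.  The factors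
    whose length is comparable to the whole prefix are caught by [O(a)] equally
    spaced positions. *)

Definition appears_within (S : finType) (w : word S) (a : nat) : Prop :=
  forall l i, 0 < l -> exists2 j, occ_at w l i j & j + l <= a * l.

(** Only the start of the occurrence is bounded; its end is at most [N + r.+1 * l], whence the
    factor [r.+1] in the scale ratio. *)
Definition recurs_within (S : finType) (w : word S) (r : nat) : Prop :=
  forall l i N, 0 < l -> exists2 t, occ_at w l i t & N <= t <= N + r * l.

Definition hits (S : finType) (w : word S) N (c : 'I_N -> nat) (L l : nat) : Prop :=
  forall i, exists j k, [/\ occ_at w l i j, j + l <= L & j <= c k < j + l].

Lemma card_ord_mem_le n (s : seq nat) : #|[set x : 'I_n | val x \in s]| <= size s.
Proof.
rewrite cardE -(size_map val); apply: uniq_leq_size.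
  by rewrite map_inj_uniq ?enum_uniq //; exact: val_inj.
by move=> x /mapP[y]; rewrite mem_enum inE => ys ->.
Qed.

(** * From real constants to integer bounds; windows and copies *)

Section Words.
Variables (S : finType) (w : word S).

Lemma occ_atP m i j :
  reflect (occ_at w m i j) [forall k : 'I_m, w (j + k) == w (i + k)].
Proof.
apply: (iffP forallP) => [h k km|h k]; last by apply/eqP/h.
exact: (eqP (h (Ordinal km))).
Qed.

(** Take the first occurrence [t] from [N] on. If there is an occurrence before [N], the last such
    one and [t] are consecutive; otherwise [t] is the first occurrence in the word. Either clause of
    the recurrence bound applies. *)
Lemma next_occurrence (C : R) l i N : 0 < l ->
  uniformly_occurring w -> recurrence_bound w C ->
  exists t, [/\ occ_at w l i t, N <= t & (INR (t - N) <= C * INR l)%R].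
Proof.
move=> l0 hu hr; have [h1 h2] := hr l i l0.
pose P t := (N <= t) && [forall k : 'I_l, w (t + k) == w (i + k)].
have exP : exists t, P t.
  by have [t [Nt ot]] := hu l i N; exists t; rewrite /P Nt; apply/occ_atP.
case: (ex_minnP exP) => t /andP[Nt /occ_atP ot] tmin.
exists t; split=> //.
have nocc k : N <= k -> k < t -> ~ occ_at w l i k.
  move=> Nk kt ok; have : P k by rewrite /P Nk; apply/occ_atP.
  by move/tmin; lia.
have sub_le s : s <= N -> (INR (t - N) <= INR (t - s))%R.
  by move=> sN; apply: le_INR; lia.
pose Q s := (s < N) && [forall k : 'I_l, w (s + k) == w (i + k)].
have [|/existsPn noQ] := boolP [exists s : 'I_N, Q s].
  case/existsP=> s0 Qs0; have exQ : exists s, Q s by exists s0.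
  have ubQ s : Q s -> s <= N by case/andP=> /ltnW.
  case: (ex_maxnP exQ ubQ) => s /andP[sN /occ_atP os] smax.
  apply: Rle_trans (sub_le s (ltnW sN)) _; apply: h2 => // [|k sk kt ok].
    exact: leq_trans sN Nt.
  have [Nk|kN] := leqP N k; first exact: nocc ok.
  have : Q k by rewrite /Q kN; apply/occ_atP.
  by move/smax; lia.
have := sub_le 0 (leq0n N); rewrite subn0 => h.
apply: Rle_trans h _; apply: h1 => // j jt oj.
have [Nj|jN] := leqP N j; first exact: nocc oj.
by apply: (negP (noQ (Ordinal jN))); rewrite /Q jN; apply/occ_atP.
Qed.

Lemma recurrence_bound_ge1 (C : R) :
  uniformly_occurring w -> recurrence_bound w C -> (1 <= C)%R.
Proof.
move=> hu hr; have [t [ot _ _]] := next_occurrence 0 0 (ltn0Sn 0) hu hr.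
have [t' [ot' tt' _]] := next_occurrence 0 t.+1 (ltn0Sn 0) hu hr.
have exP : exists u, (t < u) && [forall k : 'I_1, w (u + k) == w (0 + k)].
  by exists t'; rewrite tt'; apply/occ_atP.
case: (ex_minnP exP) => u /andP[tu /occ_atP ou] umin.
have [_ /(_ t u tu ot ou) ut] := hr 1 0 isT.
have : (INR (u - t) <= C * INR 1)%R.
  apply: ut => k tk ku ok.
  have : u <= k by apply: umin; rewrite tk; apply/occ_atP.
  by lia.
have : (INR 1 <= INR (u - t))%R by apply: le_INR; lia.
by rewrite [INR 1]/=; lra.
Qed.

Lemma appearance_bound_ge1 (C : R) : appearance_bound w C -> (1 <= C)%R.
Proof.
move=> /(_ 1 0 isT) [j [_ h]].
have : (INR 1 <= INR (j + 1))%R by apply: le_INR; lia.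
by rewrite /= in h *; lra.
Qed.

Lemma appearance_of_recurrence (C : R) :
  uniformly_occurring w -> recurrence_bound w C -> appearance_bound w (C + 1).
Proof.
move=> hu hr m i m0; have [j [oj _ hj]] := next_occurrence i 0 m0 hu hr.
by exists j; split=> //; rewrite subn0 in hj; rewrite plus_INR; lra.
Qed.

Lemma appears_within_of_bound (C : R) a :
  appearance_bound w C -> (C <= INR a)%R -> appears_within w a.
Proof.
move=> hC Ca l i l0; have [j [oj hj]] := hC l i l0.
exists j => //; apply/leP/INR_le; rewrite mult_INR.
by apply: Rle_trans hj _; apply: Rmult_le_compat_r => //; apply: pos_INR.
Qed.

Lemma recurs_within_of_bound (C : R) r :
  uniformly_occurring w -> recurrence_bound w C -> (C <= INR r)%R ->
  recurs_within w r.
Proof.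
move=> hu hC Cr l i N l0; have [t [ot Nt ht]] := next_occurrence i N l0 hu hC.
exists t => //; rewrite Nt -leq_subLR /=; apply/leP/INR_le; rewrite mult_INR.
by apply: Rle_trans ht _; apply: Rmult_le_compat_r => //; apply: pos_INR.
Qed.

Lemma appears_within_gt0 a : appears_within w a -> 0 < a.
Proof. by move=> ha; have [j _] := ha 1 0 isT; case: a {ha} => //; lia. Qed.

(** An occurrence of length at least [2 * m - 1] covers a full window, hence the position chosen
    there; as [l <= 4 * m], it can be taken within [4 * a * m]. *)
Lemma hits_of_windows a m l (c : 'I_(4 * a) -> nat) :
  appears_within w a -> 0 < m -> (forall k : 'I_(4 * a), k * m <= c k < k.+1 * m) ->
  2 * m <= l.+1 -> l <= 4 * m -> hits w c (4 * a * m) l.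
Proof.
move=> ha m0 hc ml lm i; have l0 : 0 < l by lia.
have [j oj jl] := ha l i l0.
have jL : j + l <= 4 * a * m by nia.
(* The ceiling of [j / m]: the first window starting at or after [j]. *)
pose k := (j + m.-1) %/ m.
have jk : j <= k * m.
  by have := ltn_ceil (j + m.-1) m0; rewrite -/k; lia.
have kj : k * m <= j + m.-1 by exact: leq_divM.
have kN : k < 4 * a by rewrite -(ltn_pmul2r m0); lia.
exists j, (Ordinal kN); split=> //.
by have := hc (Ordinal kN); rewrite /=; lia.
Qed.

(** Each position moves with its own copy of the prefix, taking along the occurrences that contain
    it; the copies need not be related. *)
Lemma hits_shift N (c t : 'I_N -> nat) L L' l : hits w c L l ->
  (forall k, occ_at w L 0 (t k)) -> (forall k, t k + L <= L') ->
  hits w (fun k => t k + c k) L' l.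
Proof.
move=> hc ot tL i; have [j [k [oj jL jc]]] := hc i.
exists (t k + j), k; split; last by lia.
- by move=> x xl; rewrite -addnA (ot k) ?add0n; [exact: oj|lia].
- by have := tL k; lia.
Qed.

(** * Chains of scales with ratio [2 ^ b] *)

Section Scales.
Variables (a r b : nat).
Hypotheses (ha : appears_within w a) (hr : recurs_within w r).
Hypotheses (b0 : 0 < b) (hb : 4 * a * r.+1 <= 2 ^ b).

(** Induction on [e] in steps of [b]: one set of [4 * a] positions serves all scales [e'] below [e]
    in the same residue class modulo [b]. *)
Lemma chain_positions e :
  exists2 c : 'I_(4 * a) -> nat, (forall k : 'I_(4 * a), k * 2 ^ e <= c k < k.+1 * 2 ^ e) &
    forall e' l, e' <= e -> b %| e - e' ->
      2 * 2 ^ e' <= l.+1 -> l <= 4 * 2 ^ e' -> hits w c (4 * a * 2 ^ e) l.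
Proof.
elim/ltn_ind: e => e IH; have a0 := appears_within_gt0 ha.
have pe x : 0 < 2 ^ x by rewrite expn_gt0.
have [eb|be] := ltnP e b.
  have cP (k : 'I_(4 * a)) : k * 2 ^ e <= k * 2 ^ e < k.+1 * 2 ^ e.
    by have := pe e; lia.
  exists (fun k : 'I__ => k * 2 ^ e) => // e' l e'e bd; have -> : e' = e.
    have [//|ne] := posnP (e - e'); first by lia.
    by have := dvdn_leq ne bd; lia.
  exact: hits_of_windows.
have [|c cP hc] := IH (e - b); first by lia.
have eE : 2 ^ e = 2 ^ b * 2 ^ (e - b) by rewrite -expnD subnKC.
set m := 2 ^ (e - b) in eE cP hc *; have m0 : 0 < m by exact: pe.
have tP (k : 'I_(4 * a)) : exists t,
    occ_at w (4 * a * m) 0 t /\ k * 2 ^ e <= t <= k * 2 ^ e + r * (4 * a * m).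
  have [|t ot tb] := hr 0 (k * 2 ^ e) (l := 4 * a * m); last by exists t.
  by rewrite !muln_gt0 a0 m0.
have [t /all_and2[ot tb]] := fin_all_exists tP.
(* A copy of the previous prefix, found by recurrence from the left end of a window, ends inside
   that window. *)
have LM : r * (4 * a * m) + 4 * a * m <= 2 ^ e.
  by rewrite eE -mulSnr mulnA leq_mul2r [r.+1 * _]mulnC hb orbT.
have cL k : c k < 4 * a * m.
  have /andP[_ /leq_trans->//] := cP k.
  by rewrite leq_mul2r ltn_ord orbT.
have tcP (k : 'I_(4 * a)) : k * 2 ^ e <= t k + c k < k.+1 * 2 ^ e.
  by have := tb k; have := cL k; rewrite [k.+1 * _]mulSn; lia.
exists (fun k => t k + c k) => // e' l e'e bd h1 h2.
have [ee|ne] := eqVneq e' e; first by subst e'; exact: hits_of_windows.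
have bee : b <= e - e' by apply: dvdn_leq bd; lia.
apply: hits_shift (hc e' l _ _ h1 h2) ot _ => [||k].
- by lia.
- have -> : e - b - e' = e - e' - b by lia.
  exact: dvdn_sub.
- have := tb k; have : k.+1 * 2 ^ e <= 4 * a * 2 ^ e.
    by rewrite leq_mul2r ltn_ord orbT.
  by rewrite [k.+1 * _]mulSn; lia.
Qed.

Lemma prefix_attractor_exists n : 0 < n ->
  exists2 A : {set 'I_n}, prefix_string_attractor w A & #|A| <= a * (4 * b + 8).
Proof.
move=> n0; have a0 := appears_within_gt0 ha.
have [na|an] := ltnP n (4 * a).
  exists setT; last by rewrite cardsT card_ord; nia.
  move=> p q pq qn; exists p; split=> //; first by lia.
  by exists (Ordinal qn); rewrite inE /=; split=> //; lia.
(* [E] is the largest exponent with [4 * a * 2 ^ E <= n], so [n < 8 * a * 2 ^ E]. *)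
pose E := trunc_log 2 (n %/ (4 * a)).
have /trunc_log_bounds-/(_ 2 isT) : 0 < n %/ (4 * a) by rewrite divn_gt0; lia.
rewrite -/E /= => /andP[].
rewrite leq_divRL ?ltn_divLR ?muln_gt0 // => En nE.
have pE : 0 < 2 ^ E by rewrite expn_gt0.
have cex (d : 'I_b) : exists c : 'I_(4 * a) -> nat,
    forall e' l, e' <= E - d -> b %| E - d - e' ->
    2 * 2 ^ e' <= l.+1 -> l <= 4 * 2 ^ e' -> hits w c (4 * a * 2 ^ (E - d)) l.
  by have [c _ hc] := chain_positions (E - d); exists c.
have [c cP] := fin_all_exists cex.
(* One chain per residue class modulo [b] handles lengths below [2 ^ E]; the multiples of [2 ^ E]
   meet every longer factor in place. *)
pose s := [seq c x.1 x.2 | x : 'I_b * 'I_(4 * a)]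
  ++ [seq k * 2 ^ E | k <- iota 0 (8 * a)].
exists [set x : 'I_n | val x \in s]; last first.
  apply: leq_trans (card_ord_mem_le _ _) _.
  rewrite size_cat size_codom size_map size_iota card_prod !card_ord.
  by lia.
move=> p q pq qn; pose l := (q - p).+1.
have [lE|El] := ltnP l (2 ^ E).
  (* For [l = 1] the predecessor truncates to 0, and [2 * 2 ^ e' <= l.+1] still holds, with
     equality. *)
  pose e' := (trunc_log 2 l).-1.
  have [h1 h2] : 2 * 2 ^ e' <= l.+1 /\ l <= 4 * 2 ^ e'.
    have := trunc_log_bounds (isT : 1 < 2) (ltn0Sn (q - p)).
    rewrite /= -/l /e'; case: (trunc_log 2 l) => [|f] /=.
      by rewrite expn0 expn1; lia.
    by rewrite !expnS; lia.
  have e'E : e' <= E.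
    by rewrite -(leq_exp2l (m := 2)) //; lia.
  pose d := Ordinal (ltn_pmod (E - e') b0).
  have dE : E - e' = (E - e') %/ b * b + d by exact: divn_eq.
  have dle : d <= E - e' by exact: leq_mod.
  clearbody d.
  have [||j [k [oj jL jc]]] := cP d e' l _ _ h1 h2 p.
  - by lia.
  - have -> : E - d - e' = (E - e') %/ b * b by lia.
    exact: dvdn_mull.
  - have jn : j + l <= n.
      apply: leq_trans jL _; apply: leq_trans En.
      by rewrite mulnC leq_mul2r leq_exp2l // leq_subr orbT.
    exists j; split=> //; first by lia.
    have cn : c d k < n by lia.
    exists (Ordinal cn); split; last by rewrite /=; lia.
    by rewrite inE /= mem_cat; apply/orP; left; apply/codomP; exists (d, k).
pose k := (p + (2 ^ E).-1) %/ 2 ^ E.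
have pk : p <= k * 2 ^ E.
  by have := ltn_ceil (p + (2 ^ E).-1) pE; rewrite -/k; lia.
have kp : k * 2 ^ E <= p + (2 ^ E).-1 by exact: leq_divM.
exists p; split=> //; first by lia.
have kn : k * 2 ^ E < n by lia.
exists (Ordinal kn); split; last by rewrite /=; lia.
rewrite inE /= mem_cat; apply/orP; right; apply/mapP; exists k => //.
rewrite mem_iota /= add0n -(ltn_pmul2r pE).
by rewrite expnS in nE; lia.
Qed.

End Scales.
End Words.

(** * Numerical estimates and conclusion *)

Lemma nat_ceil (x : R) : (1 <= x)%R ->
  exists m : nat, (x <= INR m <= x + 1)%R.
Proof.
move=> x1; have [h1 h2] := archimed x; exists (Z.to_nat (up x)).
rewrite INR_IZR_INZ Z2Nat.id; first by lra.
by apply: le_IZR; lra.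
Qed.

Lemma ln_le (x y : R) : (0 < x)%R -> (x <= y)%R -> (ln x <= ln y)%R.
Proof.
move=> x0 [xy|->]; last exact: Rle_refl.
by apply: Rlt_le; apply: ln_increasing.
Qed.

(** Minimality of [b = up_log 2 N] gives [2 ^ b <= 72 * x ^ 2]. Take logarithms and use [ln 2 > 1/2]
    and the crude [ln 72 <= 71]. *)
Lemma log_scale_bound (x : R) N : (1 <= x)%R -> 1 < N -> (INR N <= 36 * x ^ 2)%R ->
  (INR (up_log 2 N) <= 144 * (1 + ln x))%R.
Proof.
move=> x1 N1 Nx; have /andP[bN _] := up_log_bounds (isT : 1 < 2) N1.
set b := up_log 2 N in bN *.
have b0 : 0 < b by rewrite up_log_gt0.
have : (2 ^ b <= 72 * x ^ 2)%R.
  have -> : b = b.-1.+1 by rewrite prednK.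
  have : (INR (2 ^ b.-1) <= INR N)%R by apply: le_INR; lia.
  have -> : INR (2 ^ b.-1) = (2 ^ b.-1)%R.
    by elim: (b.-1) => // k IH; rewrite expnS mult_INR IH.
  by rewrite [(2 ^ _.+1)%R]/=; lra.
move=> h; have p2 : (0 < 2 ^ b)%R by apply: pow_lt; lra.
have := ln_le p2 h; rewrite ln_pow; last by lra.
rewrite ln_mult; [|lra|by apply: pow_lt; lra].
rewrite ln_pow; last by lra.
have ln72 : (ln 72 <= 71)%R.
  rewrite -[X in (_ <= X)%R]ln_exp; apply: ln_le; first by lra.
  by have := exp_ineq1_le 71; lra.
have lnx : (0 <= ln x)%R by rewrite -ln_1; apply: ln_le; lra.
have := Rmult_le_compat_l _ _ _ (pos_INR b) (Rlt_le _ _ ln_lt_2).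
by rewrite [INR 2]/=; lra.
Qed.

(** The factor is [1 + ln Rw] because a constant word has [Rw = 1], where the logarithm vanishes but
    an attractor is nonempty. *)
Theorem theorem17 :
  exists K : R, forall (S : finType) (w : word S) (Aw Rw : R),
    linearly_recurrent w ->
    least_const (appearance_bound w) Aw ->
    least_const (recurrence_bound w) Rw ->
    forall n : nat, 0 < n ->
      exists A : {set 'I_n}, prefix_string_attractor w A /\
        (INR #|A| <= K * Aw * (1 + ln Rw))%R.
Proof.
(* [1168 = 2 * (4 * 144 + 8)], where 2 comes from [a <= Aw + 1 <= 2 * Aw]. *)
exists 1168%R => S w Aw Rw [hu _] [hA minA] [hR _] n n0.
have A1 := appearance_bound_ge1 hA.
have R1 := recurrence_bound_ge1 hu hR.
have AR := minA _ (appearance_of_recurrence hu hR).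
have [a [Aa aA]] := nat_ceil A1.
have [r [Rr rR]] := nat_ceil R1.
have ha := appears_within_of_bound hA Aa.
have hr := recurs_within_of_bound hu hR Rr.
have a0 := appears_within_gt0 ha.
pose N := 4 * a * r.+1.
have N1 : 1 < N by rewrite /N; nia.
(* Both [a] and [r.+1] are at most [Rw + 2 <= 3 * Rw]. *)
have NR : (INR N <= 36 * Rw ^ 2)%R.
  rewrite /N !mult_INR [INR r.+1]S_INR [INR 4]/=.
  have -> : (36 * Rw ^ 2 = (4 * (3 * Rw)) * (3 * Rw))%R by ring.
  apply: Rmult_le_compat; have := pos_INR a; have := pos_INR r; lra.
have bR := log_scale_bound R1 N1 NR.
have b0 : 0 < up_log 2 N by rewrite up_log_gt0.
have [A hAt cA] := prefix_attractor_exists ha hr b0 (up_logP N (isT : 1 < 2)) n0.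
exists A; split=> //.
apply: (Rle_trans _ (INR (a * (4 * up_log 2 N + 8)))).
  by apply: le_INR; apply/leP.
have lnR : (0 <= ln Rw)%R by rewrite -ln_1; apply: ln_le; lra.
rewrite mult_INR plus_INR mult_INR.
have -> : (1168 * Aw * (1 + ln Rw) = (2 * Aw) * (584 * (1 + ln Rw)))%R by ring.
have -> : INR 4 = 4%R by rewrite /=; lra.
have -> : INR 8 = 8%R by rewrite /=; lra.
by apply: Rmult_le_compat; have := pos_INR a; have := pos_INR (up_log 2 N); lra.
Qed.
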